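(* Consider the single-pilot full-guard OTFS pattern on a $K\times M$ delay--Doppler grid, with pilot at $(k_p,m_p)$ satisfying $L-1\le k_p\le K-L$. Then the shifted pilot vectors have disjoint supports across different delay taps, i.e., $$\mathbf{z}_{p,i}^{*}\odot\mathbf{z}_{p,j}=\mathbf{0},\quad i\ne j,\ i,j\in\{0,\ldots,L-1\},$$ and each shifted pilot vector satisfies $$\|\mathbf{z}_{p,i}\|^2=\mathcal{E}_p,\quad i=0,\ldots,L-1,$$ where $\mathcal{E}_p=|s_p|^2$ is the pilot energy. Consequently, for any BEM basis matrix $\boldsymbol{\Phi}\in\mathbb{C}^{N\times Q}$, the pattern satisfies the zero pilot--pilot leakage (ZPPL) condition $$\boldsymbol{\Psi}_{p,i}^H\boldsymbol{\Psi}_{p,j}=\mathbf{0}\quad\text{for all }i\ne j,\ i,j\in\{0,\ldots,L-1\}.$$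
   Context: Let $K,M,L,Q$ be positive integers and $N=KM$. The delay--Doppler grid is a matrix $\mathbf{S}\in\mathbb{C}^{K\times M}$ with rows (delay bins) indexed by $k\in\{0,\ldots,K-1\}$ and columns (Doppler bins) by $m\in\{0,\ldots,M-1\}$. Single-pilot full-guard pattern: for a pilot position $(k_p,m_p)$ and pilot symbol $s_p\in\mathbb{C}$, $\mathbf{S}[k_p,m_p]=s_p$; $\mathbf{S}[k,m]=0$ whenever $k_p-L+1\le k\le k_p+L-1$, $0\le m\le M-1$ and $(k,m)\ne(k_p,m_p)$; all other cells carry payload symbols. Let $\mathbf{S}_{\mathrm{pilot}}\in\mathbb{C}^{K\times M}$ be the grid containing only the pilot symbol $s_p$ at $(k_p,m_p)$ and zeros elsewhere. The time-domain pilot vector is $\mathbf{x}_p=(\mathbf{F}_M^H\otimes\mathbf{I}_K)\,\mathrm{vec}(\mathbf{S}_{\mathrm{pilot}})\in\mathbb{C}^N$, where $\mathrm{vec}$ stacks columns and $\mathbf{F}_M$ is the unitary $M$-point DFT matrix, $[\mathbf{F}_M]_{a,b}=M^{-1/2}e^{-j2\pi ab/M}$. With a cyclic prefix, the shifted pilot vectors are $\mathbf{z}_{p,\ell}=\boldsymbol{\Pi}^\ell\mathbf{x}_p$, $\ell=0,\ldots,L-1$, where $(\boldsymbol{\Pi}^\ell\mathbf{x})[n]=\mathbf{x}[(n-\ell)\bmod N]$. The per-tap pilot observation matrices (time-domain) are $\boldsymbol{\Psi}_{p,\ell}=\mathrm{diag}(\mathbf{z}_{p,\ell})\boldsymbol{\Phi}\in\mathbb{C}^{N\times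 Q}$. $\odot$ is the entrywise product and $(\cdot)^*$ entrywise complex conjugation. *)

(* Defs.v *)
(* The complex numbers are R[i] for an arbitrary R : realType. *)
From mathcomp Require Export all_boot all_order all_algebra.
From mathcomp Require Export reals trigo.
From mathcomp Require Export complex mxtens.

Set Implicit Arguments.
Unset Strict Implicit.
Unset Printing Implicit Defensive.

Import Order.TTheory GRing.Theory Num.Theory.

Local Open Scope ring_scope.
Local Open Scope complex_scope.

Lemma index_allpairs (T1 T2 : eqType) (s1 : seq T1) (s2 : seq T2) x1 x2 :
  x1 \in s1 -> x2 \in s2 ->
  index (x1, x2) [seq (y1, y2) | y1 <- s1, y2 <- s2]
    = (index x1 s1 * size s2 + index x2 s2)%N.
Proof.
move=> + x2s; elim: s1 => //= y s1 IH; rewrite inE index_cat size_map eq_sym.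
have [<- _|yx] /= := eqVneq y x1.
  by rewrite map_f ?index_map ?x2s // => ? ? [].
move=> /[dup] /IH -> _; rewrite ifF ?mulSn ?addnA //.
by apply/negP => /mapP[z _ [yE]]; rewrite yE eqxx in yx.
Qed.

Lemma val_mxvec_index m n (i : 'I_m) (j : 'I_n) :
  mxvec_index i j = (i * n + j)%N :> nat.
Proof.
transitivity (index (i, j) (enum {: 'I_m * 'I_n})).
  rewrite /mxvec_index /=; have := nth_enum_rank (i, j) (i, j).
  move=> /(congr1 (fun z => index z (enum {: 'I_m * 'I_n}))) <-.
  by rewrite index_uniq ?enum_uniq // -cardE.
rewrite enumT unlock /= /prod_enum index_allpairs ?mem_enum //.
by rewrite !index_enum_ord size_enum_ord.
Qed.

Section Generic.
Variable R : realType.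
Local Notation C := R[i].

(* exp (j t) for real t, by Euler's formula *)
Definition expi (t : R) : C := cos t +i* sin t.

Definition dft (M : nat) : 'M[C]_M :=
  \matrix_(a < M, b < M)
    (((Num.sqrt M%:R)^-1)%:C * expi (- (2 * pi * (a * b)%N%:R / M%:R))).

Definition adjmx m n (A : 'M[C]_(m, n)) : 'M[C]_(n, m) :=
  map_mx Num.conj A^T.

Definition hadamard m n (A B : 'M[C]_(m, n)) : 'M[C]_(m, n) :=
  map2_mx *%R A B.

Definition conjmx m n (A : 'M[C]_(m, n)) : 'M[C]_(m, n) := map_mx Num.conj A.

(* The squared Euclidean norm, a nonnegative real element of C. *)
Definition sqnorm n (x : 'cV[C]_n) : C := \sum_(k < n) `|x k 0| ^+ 2.

(* mxvec lists the rows of its argument one after the other, so column stacking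
   is mxvec of the transpose: S k m sits at position m * K + k. *)
Definition vec K M (S : 'M[C]_(K, M)) : 'cV[C]_(M * K) := (mxvec S^T)^T.

Lemma vecE K M (S : 'M[C]_(K, M)) (n : 'I_(M * K)) (k : 'I_K) (m : 'I_M) :
  n = (m * K + k)%N :> nat -> vec S n 0 = S k m.
Proof.
move=> nE; have -> : n = mxvec_index m k.
  by apply/val_inj; rewrite /= nE -val_mxvec_index.
by rewrite /vec mxE mxvecE mxE.
Qed.

(* (cshift x)[n] = x[(n - 1) mod N] *)
Definition cshift N : 'M[C]_N := \matrix_(n, n') (n' == ord_pred n)%:R.

Lemma cshiftXE N (x : 'cV[C]_N) (l : nat) (n n' : 'I_N) :
  n' + l = n %[mod N] -> (cshift N ^+ l *m x) n 0 = x n' 0.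
Proof.
elim: l n n' => [|l IH] n n' e.
  have -> : n = n'.
    by apply/val_inj; move: e; rewrite addn0 !modn_small.
  by rewrite expr0 mul1mx.
rewrite exprS -[_ * _]/(_ *m _) -mulmxA mxE (bigD1 (ord_pred n)) //=.
rewrite big1 ?addr0 => [|i /negPf ni]; last by rewrite mxE ni mul0r.
rewrite mxE eqxx mul1r; apply: IH; rewrite /= modn_mod.
apply/eqP; rewrite -(eqn_modDr 1) !addn1 -addnS prednK; last first.
  by rewrite addn_gt0 (leq_trans _ (ltn_ord n)) ?orbT.
by rewrite e modnDr.
Qed.

End Generic.

Section Pattern.
Variable R : realType.
Local Notation C := R[i].
Variables K M : nat.

(* The payload cells, outside the guard rows, are unconstrained.  The truncated
   subtraction is harmless: rows below 0 do not exist. *)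
Definition single_pilot_full_guard (L : nat) (kp : 'I_K) (mp : 'I_M) (sp : C)
    (S : 'M[C]_(K, M)) : Prop :=
  S kp mp = sp /\
  forall (k : 'I_K) (m : 'I_M), (kp - L.-1 <= k <= kp + L.-1)%N ->
    (k, m) != (kp, mp) -> S k m = 0.

Definition pilot_grid (kp : 'I_K) (mp : 'I_M) (sp : C) : 'M[C]_(K, M) :=
  \matrix_(k, m) if (k, m) == (kp, mp) then sp else 0.

(* The time-domain length K M is written M * K, the dimension type of the
   Kronecker product of an M x M by a K x K matrix. *)
Definition pilot_vector (kp : 'I_K) (mp : 'I_M) (sp : C) : 'cV[C]_(M * K) :=
  (adjmx (dft R M) *t (1%:M : 'M[C]_K)) *m vec (pilot_grid kp mp sp).

Definition shifted_pilot (kp : 'I_K) (mp : 'I_M) (sp : C) (l : nat) :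
    'cV[C]_(M * K) :=
  cshift R (M * K) ^+ l *m pilot_vector kp mp sp.

Definition pilot_observation Q (kp : 'I_K) (mp : 'I_M) (sp : C)
    (Phi : 'M[C]_(M * K, Q)) (l : nat) : 'M[C]_(M * K, Q) :=
  diag_mx (shifted_pilot kp mp sp l)^T *m Phi.

End Pattern.

Definition pilot_energy (R : realType) (sp : R[i]) : R[i] := `|sp| ^+ 2.

(* Zero pilot-pilot leakage between the observation matrices of the L taps. *)
Definition zppl (R : realType) (N Q L : nat) (Psi : 'I_L -> 'M[R[i]]_(N, Q)) :
    Prop :=
  forall i j : 'I_L, i != j -> adjmx (Psi i) *m Psi j = 0.

(* Main.v *)
(* The pilot vector is supported on the time indices congruent to kp modulo K,
   where its entries have squared modulus |sp|^2 / M.  Shifting by l moves this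
   residue class to kp + l, which does not wrap around for l < L; hence the
   supports of distinct taps are disjoint.  Both the entrywise products and the
   entries of the Gram matrix of the observations only involve products of
   entries of two taps at the same time index. *)
From Pilot Require Import Defs.

Import GRing.Theory Num.Theory.
Local Open Scope ring_scope.
Local Open Scope complex_scope.

Lemma iter_ord_predD (N l : nat) (n : 'I_N) :
  (iter l (@ord_pred N) n + l = n %[mod N])%N.
Proof.
elim: l => [|l IH] /=; first by rewrite addn0.
set n' := iter l _ n in IH *.
rewrite modnDml addnS -addSn prednK; last first.
  by rewrite addn_gt0 (leq_trans _ (ltn_ord n)) ?orbT.
by rewrite addnAC modnDr.
Qed.

(** Giving the source index as an explicit function of [n] lets sums be reindexed and residues be
    tracked through the shift. *)
Lemma cshiftX_iter (R : realType) (N l : nat) (x : 'cV[R[i]]_N) (n : 'I_N) :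
  (cshift R N ^+ l *m x) n 0 = x (iter l (@ord_pred N) n) 0.
Proof. exact/cshiftXE/iter_ord_predD. Qed.

(** The iterated cyclic predecessor is injective on a finite type, so the shift only permutes the
    entries. *)
Lemma sqnorm_cshiftX (R : realType) (N l : nat) (x : 'cV[R[i]]_N) :
  sqnorm (cshift R N ^+ l *m x) = sqnorm x.
Proof.
have pred_inj : injective (iter l (@ord_pred N)).
  by elim: l => [|l IH] // a b /= /ord_pred_inj /IH.
rewrite /sqnorm [RHS](reindex_inj pred_inj).
by apply: eq_bigr => n _; rewrite cshiftX_iter.
Qed.

Lemma normr_expi (R : realType) (t : R) : `|expi t| = 1.
Proof. by rewrite /expi normc_def /= cos2Dsin2 sqrtr1. Qed.

Lemma normr_dft_sq (R : realType) (M : nat) (a b : 'I_M) :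
  `|dft R M a b| ^+ 2 = M%:R^-1.
Proof.
rewrite mxE normrM normr_expi mulr1 normc_def /= expr0n addr0 sqrtr_sqr.
rewrite -rmorphXn real_normK ?num_real // exprVn sqr_sqrtr ?ler0n //.
by rewrite fmorphV rmorph_nat.
Qed.

Section PilotVectors.
Variables (R : realType) (K M : nat) (kp : 'I_K) (mp : 'I_M) (sp : R[i]).

(** Only column [(mp, kp)] of the Kronecker product meets the single pilot cell. Its identity factor
    confines the delay to [kp]; its adjoint DFT factor supplies the conjugate. *)
Lemma pilot_vectorE (m : 'I_M) (k : 'I_K) :
  pilot_vector kp mp sp (mxtens_index (m, k)) 0
    = if k == kp then (dft R M mp m)^* * sp else 0.
Proof.
rewrite mxE (bigD1 (mxtens_index (mp, kp))) //= big1 => [|n].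
  rewrite addr0 tensmxE (@vecE _ _ _ _ _ kp mp) //.
  by rewrite !mxE eqxx; case: eqP => _; rewrite ?mulr1 // mulr0 mul0r.
case: (mxtens_indexP n) => m' k'.
rewrite (@vecE _ _ _ _ _ k' m') // [pilot_grid _ _ _ _ _]mxE.
by have [[-> ->]|_] := eqVneq (k', m') (kp, mp); rewrite ?eqxx ?mulr0.
Qed.

Lemma shifted_pilot_eq0 (l : nat) (n : 'I_(M * K)) :
  n != (kp + l)%N %[mod K] -> shifted_pilot kp mp sp l n 0 = 0.
Proof.
move=> nkl; rewrite cshiftX_iter.
have := @iter_ord_predD _ l n; set n' := iter _ _ _.
(* The congruence modulo [M * K] descends to one modulo [K], where the block offset [m * K]
   disappears. *)
case: (mxtens_indexP n') => m k /(congr1 (modn^~ K)).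
rewrite !modn_dvdm ?dvdn_mull //= -addnA modnMDl => nE.
rewrite pilot_vectorE; have [kE|//] := eqVneq k kp.
by rewrite -nE kE eqxx in nkl.
Qed.

Lemma sqnorm_shifted_pilot (l : nat) :
  sqnorm (shifted_pilot kp mp sp l) = pilot_energy sp.
Proof.
rewrite sqnorm_cshiftX /sqnorm.
rewrite (reindex (@mxtens_index M K)) /=; last first.
  by exists (@mxtens_unindex M K) => n _;
    rewrite (mxtens_indexK, mxtens_unindexK).
rewrite (eq_bigr (fun p : 'I_M * 'I_K =>
    if p.2 == kp then M%:R^-1 * `|sp| ^+ 2 else 0)) => [|[m k] _]; last first.
  rewrite pilot_vectorE /=; case: eqP => _; last by rewrite normr0 expr0n.
  by rewrite normrM norm_conjC exprMn normr_dft_sq.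
rewrite -(pair_bigA _ (fun (m : 'I_M) (k : 'I_K) =>
    if k == kp then M%:R^-1 * `|sp| ^+ 2 else 0)) /=.
(* Each inner sum keeps only [k = kp], leaving [M] equal terms; [M] is nonzero because [mp] inhabits
   ['I_M]. *)
under eq_bigr do rewrite -big_mkcond big_pred1_eq.
rewrite sumr_const card_ord -[LHS]mulr_natl mulrA divff ?mul1r //.
by rewrite pnatr_eq0 -lt0n (leq_trans _ (ltn_ord mp)).
Qed.

Lemma shifted_pilot_disjoint (L : nat) (i j : 'I_L) (n : 'I_(M * K)) :
  (kp + L <= K)%N -> i != j ->
  (shifted_pilot kp mp sp i n 0)^* * shifted_pilot kp mp sp j n 0 = 0.
Proof.
move=> kpL ij.
have tap_small (l : 'I_L) : (kp + l < K)%N.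
  by apply: leq_trans kpL; rewrite ltn_add2l.
(* Outside the residue class of tap [i] the first factor vanishes. Inside it [n] misses the class of
   tap [j], since [kp + i] and [kp + j] are distinct and both below [K]. *)
have [ni|ni] := eqVneq (n %% K)%N ((kp + i) %% K)%N; last first.
  by rewrite (shifted_pilot_eq0 _ _ ni) conjC0 mul0r.
rewrite (shifted_pilot_eq0 j) ?mulr0 //.
by rewrite ni !modn_small ?eqn_add2l.
Qed.

End PilotVectors.

Theorem proposition4 (R : realType) (K M L Q : nat)
    (hK : (0 < K)%N) (hM : (0 < M)%N) (hL : (0 < L)%N) (hQ : (0 < Q)%N)
    (kp : 'I_K) (mp : 'I_M) (sp : R[i]) (S : 'M[R[i]]_(K, M))
    (hS : single_pilot_full_guard L kp mp sp S)
    (hkp : (L.-1 <= kp)%N) (hkp' : (kp + L <= K)%N) :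
  (forall i j : 'I_L, i != j ->
     hadamard (conjmx (shifted_pilot kp mp sp i)) (shifted_pilot kp mp sp j)
       = 0)
  /\ (forall i : 'I_L,
        sqnorm (shifted_pilot kp mp sp i) = pilot_energy sp)
  /\ (forall Phi : 'M[R[i]]_(M * K, Q),
        zppl (fun l : 'I_L => pilot_observation kp mp sp Phi l)).
Proof.
split; [|split] => [i j ij|i|Phi i j ij].
- apply/matrixP => n c; rewrite ord1 [LHS]mxE [RHS]mxE [conjmx _ _ _]mxE.
  exact: shifted_pilot_disjoint hkp' ij.
- exact: sqnorm_shifted_pilot.
- have obsE (l : 'I_L) n q : pilot_observation kp mp sp Phi l n q
      = shifted_pilot kp mp sp l n 0 * Phi n q.
    by rewrite /pilot_observation mul_diag_mx mxE [_^T 0 n]mxE.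
  apply/matrixP => a b; rewrite [LHS]mxE [RHS]mxE big1 // => n _.
  (* Regrouping each summand pairs the two pilot entries at time [n], leaving the [Phi] entries as a
     separate factor. *)
  rewrite [adjmx _ _ _]mxE [_^T a n]mxE !obsE rmorphM mulrACA.
  by rewrite shifted_pilot_disjoint ?mul0r.
Qed.
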